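(* Let $T>0$ and let $A,B$ be smooth real functions on $[0,T]$. Consider the Abel equation $x'=A(t)x^3+B(t)x^2$ and let $u(t,x)$ denote its solution with $u(0,x)=x$. Suppose that: $(C_1)$ $A(0)=0$; $A$ has exactly one zero $t_A$ in the open interval $(0,T)$, and this zero is simple; $B$ has exactly two zeros $t_{B_1},t_{B_2}$ in $[0,T]$, both simple; and $0<t_{B_1}<t_A<t_{B_2}\le T$; and that for every positive singular closed solution $\tilde u(t):=u(t,\tilde x)$ of the equation: $(C_2)$ the function $2A(t)\tilde u(t)+B(t)$ has at most one zero, which if it exists is simple, in each of the intervals $[0,t_A]$ and $[t_A,T]$; $(C_3)$ $\operatorname{sgn}\left(v(t,\tilde u(t))\right)=\operatorname{sgn}(A'(0)B(0))$ for all $t\in[0,T]$. Then for every positive singular closed solution $u(t,\tilde x)$ one has $\operatorname{sgn}\left(u_{xx}(T,\tilde x)\right)=\operatorname{sgn}(A'(0)B(0))$.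
   Context: A solution $u(t,x)$ is closed if it is defined on $[0,T]$ and $u(T,x)=x$; it is positive if $x>0$ (equivalently $u(t,x)>0$ for all $t$). A closed solution $u(t,\tilde x)$ is singular if $u_x(T,\tilde x)=1$, where $u_x,u_{xx}$ denote derivatives with respect to the initial condition $x$. Define $$P(t)=4\left(B(t)A'(t)-B'(t)A(t)\right)-B(t)^3,\qquad v(t,x)=B(t)\left(2A(t)x+B(t)\right)^2+P(t).$$ *)

(* Defs.v *)
From Stdlib Require Import Reals.
From Coquelicot Require Import Coquelicot.
Open Scope R_scope.

Definition Icc (a b : R) : R -> Prop := fun t => a <= t <= b.

(* Coquelicot's [is_derive] with the neighbourhood filter traced on [D]: for
   D = [a, b] this is the one-sided derivative at the end points, and the values
   of [f] outside [D] play no role. *)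
Definition is_derive_on (D : R -> Prop) (f : R -> R) (t l : R) : Prop :=
  filterdiff f (within D (locally t)) (fun y : R => scal y l).

Definition ex_derive_on (D : R -> Prop) (f : R -> R) (t : R) : Prop :=
  exists l : R, is_derive_on D f t l.

(* Total operator: meaningful when [f] is differentiable on [D] at [t] and [t]
   is an accumulation point of [D]. *)
Definition Derive_on (D : R -> Prop) (f : R -> R) (t : R) : R :=
  iota (fun l : R => is_derive_on D f t l).

Fixpoint Derive_n_on (D : R -> Prop) (f : R -> R) (n : nat) : R -> R :=
  match n with
  | O => f
  | S m => Derive_on D (Derive_n_on D f m)
  end.

Definition smooth_on (D : R -> Prop) (f : R -> R) : Prop :=
  forall (n : nat) (t : R), D t -> ex_derive_on D (Derive_n_on D f n) t.

Definition simple_zero (D : R -> Prop) (f : R -> R) (t : R) : Prop :=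
  f t = 0 /\ exists l : R, is_derive_on D f t l /\ l <> 0.

(* Simplicity is relative to [D]; zeros are counted in [E], a part of [D]. *)
Definition at_most_one_simple_zero (D E : R -> Prop) (f : R -> R) : Prop :=
  (forall s t : R, E s -> E t -> f s = 0 -> f t = 0 -> s = t) /\
  (forall t : R, E t -> f t = 0 -> simple_zero D f t).

Definition abel_solution (A B : R -> R) (s x : R) (y : R -> R) : Prop :=
  y 0 = x /\
  forall t : R, Icc 0 s t ->
    is_derive_on (Icc 0 s) y t (A t * y t ^ 3 + B t * y t ^ 2).

(* Solutions may blow up before time T, so u(t,x) is only partially defined.
   Here [u] is a total function which follows the solution starting at x for as
   long as that solution exists in [0, T]; elsewhere its value is arbitrary. *)
Definition abel_flow (A B : R -> R) (T : R) (u : R -> R -> R) : Prop :=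
  forall s x : R, Icc 0 T s ->
    (exists y : R -> R, abel_solution A B s x y) ->
    abel_solution A B s x (fun t => u t x).

Definition closed_solution (A B : R -> R) (T : R) (u : R -> R -> R) (x : R)
  : Prop :=
  abel_solution A B T x (fun t => u t x) /\ u T x = x.

Definition positive_singular_closed (A B : R -> R) (T : R) (u : R -> R -> R)
  (x : R) : Prop :=
  0 < x /\ closed_solution A B T u x /\ is_derive (fun z => u T z) x 1.

Definition Pfun (A B : R -> R) (T t : R) : R :=
  4 * (B t * Derive_on (Icc 0 T) A t - Derive_on (Icc 0 T) B t * A t) - B t ^ 3.

Definition vfun (A B : R -> R) (T t x : R) : R :=
  B t * (2 * A t * x + B t) ^ 2 + Pfun A B T t.

Definition condC1 (A B : R -> R) (T tA tB1 tB2 : R) : Prop :=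
  A 0 = 0 /\
  (forall t : R, 0 < t < T -> (A t = 0 <-> t = tA)) /\
  simple_zero (Icc 0 T) A tA /\
  (forall t : R, 0 <= t <= T -> (B t = 0 <-> t = tB1 \/ t = tB2)) /\
  simple_zero (Icc 0 T) B tB1 /\
  simple_zero (Icc 0 T) B tB2 /\
  0 < tB1 /\ tB1 < tA /\ tA < tB2 /\ tB2 <= T.

Definition condC2 (A B : R -> R) (T tA : R) (w : R -> R) : Prop :=
  let f := fun t => 2 * A t * w t + B t in
  at_most_one_simple_zero (Icc 0 T) (Icc 0 tA) f /\
  at_most_one_simple_zero (Icc 0 T) (Icc tA T) f.

Definition condC3 (A B : R -> R) (T : R) (w : R -> R) : Prop :=
  forall t : R, 0 <= t <= T ->
    sign (vfun A B T t (w t)) = sign (Derive_on (Icc 0 T) A 0 * B 0).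

(* Main.v *)
Require Import Defs.
From Stdlib Require Import Reals Lra Lia.
From Coquelicot Require Import Coquelicot.
Open Scope R_scope.

(** The theorem reduces to the orientation of a convex loop in the plane.

    Let [w] be a positive singular closed solution with initial value [x], and
    put a(t) = int_0^t A w^2 and b(t) = int_0^t B w. Since w'/w = A w^2 + B w, one
    has w = x e^(a+b), and the derivative p of the flow in the initial value is
    p = exp (int 3 A w^2 + 2 B w) = e^(3a+2b). Closed and singular mean
    a(T) + b(T) = 0 and 3 a(T) + 2 b(T) = 0, so (a, b) runs through a closed
    curve based at the origin. The equation of second variation gives
    u_xx(T) = p(T) int_0^T (6 A w + 2 B) p with p(T) = 1, and as
    (6 A w + 2 B) p = (6 a' + 2 b') e^(2a+b) / x, removing an exact derivative
    leaves ([second_variation])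

      u_xx(T) = (2/x) int_0^T a' e^(2a+b) dt,

    the weighted area enclosed by the loop, up to its orientation. The slope of
    the loop is b'/a' = B/(A w), and its time derivative is - v / (4 A^2 w)
    ([slope_derivative]), so (C_3) makes the slope strictly monotone on each of
    the two arcs (0, t_A) and (t_A, T), on which a is monotone: the arcs lie on
    opposite sides of the chord through the origin and (a(t_A), b(t_A)). If k is
    the slope of that chord, then int a' e^((2+k)a) dt = 0, and subtracting it
    leaves an integrand a' e^(2a) (e^b - e^(ka)) of the sign of v
    ([exp_loop_integral_sign]). If A'(0) B(0) = 0, then v = 0 along w, the slope
    is constant on (0, t_A), and it vanishes at t_B1; hence B = 0 on (0, t_A),
    against (C_1), and there is no positive singular closed solution.

    The other half of the work is that z |-> u(T, z) is twice differentiable with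
    the expected derivatives. The substitution y = w + p e turns solutions near
    [w] into solutions near 0 of another Abel equation, e' = beta e^3 + alpha e^2.
    Its right-hand side has no linear term, so with e(0) = h a Picard iteration
    contracts on [0, T] for small h and yields e = h + O(h^2)
    ([abel_small_solutions]). Hence u(., x + h) = w + h p + O(h^2) uniformly
    ([nearby_solutions]), which gives the first derivative exp (int 3 A u^2 + 2 B u)
    at every nearby initial value, and, once inserted in this formula, the second
    derivative at x. *)

(** * Continuity, primitives and mean values *)

Definition cont (f : R -> R) : Prop := forall t, continuous f t.

Lemma cont_const (c : R) : cont (fun _ => c).
Proof. intro t; apply continuous_const. Qed.

Lemma cont_plus (f g : R -> R) : cont f -> cont g -> cont (fun t => f t + g t).
Proof. intros Hf Hg t; exact (continuous_plus f g t (Hf t) (Hg t)). Qed.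

Lemma cont_mult (f g : R -> R) : cont f -> cont g -> cont (fun t => f t * g t).
Proof. intros Hf Hg t; exact (continuous_mult f g t (Hf t) (Hg t)). Qed.

Lemma cont_pow (f : R -> R) (n : nat) : cont f -> cont (fun t => f t ^ n).
Proof.
  intro Hf; induction n as [|n IH]; simpl.
  - apply cont_const.
  - now apply cont_mult.
Qed.

Lemma cont_comp (f g : R -> R) : cont f -> cont g -> cont (fun t => f (g t)).
Proof. intros Hf Hg t; exact (continuous_comp g f t (Hg t) (Hf (g t))). Qed.

Lemma cont_derive (f f' : R -> R) :
  (forall t, is_derive f t (f' t)) -> cont f.
Proof.
  intros H t; apply (ex_derive_continuous f t); exists (f' t); apply H.
Qed.

Lemma cont_exp (f : R -> R) : cont f -> cont (fun t => exp (f t)).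
Proof.
  intro Hf; apply (cont_comp exp f); [|exact Hf].
  apply (cont_derive exp exp); exact is_derive_exp.
Qed.

Lemma cont_RInt_integrable (f : R -> R) (a b : R) : cont f -> ex_RInt f a b.
Proof. intro Hf; apply (@ex_RInt_continuous R_CompleteNormedModule); intros z _; apply Hf. Qed.

Lemma RInt_is_derive (f : R -> R) (t : R) :
  cont f -> is_derive (fun s => RInt f 0 s) t (f t).
Proof.
  intro Hf; apply (is_derive_RInt f (fun s => RInt f 0 s) 0).
  - apply filter_forall; intro s.
    apply (RInt_correct f), (cont_RInt_integrable f 0 s Hf).
  - apply Hf.
Qed.

Lemma cont_RInt (f : R -> R) : cont f -> cont (fun t => RInt f 0 t).
Proof.
  intro Hf; apply (cont_derive _ f); intro t; now apply RInt_is_derive.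
Qed.

Ltac cont_tac :=
  lazymatch goal with
  | |- cont (fun _ => ?c) => apply cont_const
  | |- cont (fun t => _ + _) => apply cont_plus; cont_tac
  | |- cont (fun t => _ * _) => apply cont_mult; cont_tac
  | |- cont (fun t => _ ^ _) => apply cont_pow; cont_tac
  | |- cont (fun t => exp _) => apply cont_exp; cont_tac
  | |- cont (RInt _ _) => apply cont_RInt; cont_tac
  | |- cont (fun t => RInt _ _ _) => apply cont_RInt; cont_tac
  | |- _ => assumption
  end.

Lemma is_derive_Rplus (f g : R -> R) (t a b : R) :
  is_derive f t a -> is_derive g t b -> is_derive (fun s => f s + g s) t (a + b).
Proof. exact (is_derive_plus f g t a b). Qed.

Lemma is_derive_Rmult (f g : R -> R) (t a b : R) :
  is_derive f t a -> is_derive g t b ->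
  is_derive (fun s => f s * g s) t (a * g t + f t * b).
Proof. intros Hf Hg; exact (is_derive_mult f g t a b Hf Hg Rmult_comm). Qed.

Lemma is_derive_Rcst (c t : R) : is_derive (fun _ => c) t 0.
Proof. exact (is_derive_const c t). Qed.

Lemma is_derive_Rcomp (f g : R -> R) (t a b : R) :
  is_derive f (g t) a -> is_derive g t b -> is_derive (fun s => f (g s)) t (b * a).
Proof. exact (is_derive_comp f g t a b). Qed.

Lemma is_derive_exp_comp (f : R -> R) (t a : R) :
  is_derive f t a -> is_derive (fun s => exp (f s)) t (a * exp (f t)).
Proof. intro H; apply (is_derive_Rcomp exp f); [apply is_derive_exp|exact H]. Qed.

Lemma is_derive_Rinv (f : R -> R) (t a : R) :
  f t <> 0 -> is_derive f t a -> is_derive (fun s => / f s) t (- a / (f t) ^ 2).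
Proof. intros N H; exact (is_derive_inv f t a H N). Qed.

Lemma is_derive_eq (f : R -> R) (t a b : R) :
  is_derive f t a -> a = b -> is_derive f t b.
Proof. now intros H <-. Qed.

Ltac derive_steps :=
  lazymatch goal with
  | |- is_derive (fun _ => ?c) _ _ => apply is_derive_Rcst
  | |- is_derive (fun s => _ + _) _ _ => apply is_derive_Rplus; derive_steps
  | |- is_derive (fun s => _ * _) _ _ => apply is_derive_Rmult; derive_steps
  | |- is_derive (fun s => exp _) _ _ => apply is_derive_exp_comp; derive_steps
  | |- is_derive (fun s => / _) _ _ => apply is_derive_Rinv; [|derive_steps]
  | |- _ => eassumption
  end.

Ltac derive_tac :=
  unfold Rdiv; eapply is_derive_eq; [derive_steps | cbv beta; try ring].

(** The derivative is only asked for on the open interval, so that a function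
    with one-sided derivatives at the end points can be used once it has been
    extended by constants. *)
Lemma mean_value (f f' : R -> R) (a b : R) :
  a < b -> cont f -> (forall t, a < t < b -> is_derive f t (f' t)) ->
  exists c, a < c < b /\ f b - f a = f' c * (b - a).
Proof.
  intros Hab Hc Hd.
  assert (pr : forall c, a < c < b -> derivable_pt f c).
  { intros c Hcab; exists (f' c); now apply is_derive_Reals, Hd. }
  destruct (MVT f id a b pr (fun c _ => derivable_pt_id c) Hab) as [c [P E]].
  - intros c _; apply continuity_pt_filterlim, Hc.
  - intros c _; apply derivable_continuous_pt, derivable_pt_id.
  - exists c; split; [exact P|].
    rewrite derive_pt_id in E.
    rewrite (derive_pt_eq_0 f c (f' c) (pr c P)) in E.
    + unfold id in E; lra.
    + now apply is_derive_Reals, Hd.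
Qed.

Lemma constant_of_zero_derivative (f : R -> R) (a b : R) :
  cont f -> (forall t, a < t < b -> is_derive f t 0) ->
  forall t, a <= t <= b -> f t = f a.
Proof.
  intros Hc Hd t Ht.
  destruct (Req_dec t a) as [->|N]; [reflexivity|].
  destruct (mean_value f (fun _ => 0) a t) as [c [_ E]]; [lra|exact Hc| |lra].
  intros s Hs; apply Hd; lra.
Qed.

(** The function y exp(-int c) has derivative zero. *)
Lemma linear_solution (c y : R -> R) (T : R) :
  cont c -> cont y ->
  (forall t, 0 < t < T -> is_derive y t (c t * y t)) ->
  forall t, 0 <= t <= T -> y t = y 0 * exp (RInt c 0 t).
Proof.
  intros Hc Hy Hd t Ht.
  set (f := fun t => y t * exp (- 1 * RInt c 0 t)).
  assert (E : f t = f 0).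
  { apply (constant_of_zero_derivative f 0 T); [| |exact Ht].
    - unfold f; cont_tac.
    - intros s Hs; unfold f.
      pose proof (Hd s Hs) as D1; pose proof (RInt_is_derive c s Hc) as D2.
      derive_tac. }
  unfold f in E; rewrite RInt_point in E.
  change (@zero R_CompleteNormedModule) with 0 in E.
  rewrite Rmult_0_r, exp_0, Rmult_1_r in E; rewrite <- E, Rmult_assoc, <- exp_plus.
  replace (- 1 * RInt c 0 t + RInt c 0 t) with 0 by ring.
  rewrite exp_0; ring.
Qed.

Lemma cont_sign_constant (f : R -> R) (a b : R) :
  cont f -> (forall t, a < t < b -> f t <> 0) ->
  forall s t, a < s < b -> a < t < b -> 0 < f s * f t.
Proof.
  intros Hc Hn s t Hs Ht.
  destruct (Rlt_dec 0 (f s * f t)) as [|N]; [assumption|exfalso].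
  destruct (IVT_gen f s t 0) as [c [Hc1 Hc2]].
  - intro z; apply continuity_pt_filterlim, Hc.
  - unfold Rmin, Rmax; destruct (Rle_dec (f s) (f t)); split; nra.
  - apply (Hn c); [|exact Hc2].
    unfold Rmin, Rmax in Hc1; destruct (Rle_dec s t); lra.
Qed.

Lemma cont_bounded (f : R -> R) (a b : R) :
  cont f -> exists M, 0 < M /\ forall t, a <= t <= b -> Rabs (f t) <= M.
Proof.
  intro Hf.
  destruct (bounded_continuity f a b) as [M HM]; [intros; apply Hf|].
  exists (Rabs M + 1); split; [pose proof (Rabs_pos M); lra|].
  intros t Ht; specialize (HM t Ht); change (Rabs (f t) < M) in HM.
  pose proof (Rle_abs M); lra.
Qed.

(** A function that vanishes at both ends of an interval and has decreasing slope
    [k] in time, with respect to a monotone parameter of speed [m], lies strictly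
    on the side of its chord given by the sign of [m].
    The mean value theorem on both sides of [t] expresses m(t) q(t) as a positive
    multiple of [k] at an earlier point and as a negative multiple of [k] at a
    later one, and the first value of [k] is the larger. *)
Lemma arc_sign (q m k : R -> R) (c d : R) :
  cont q -> q c = 0 -> q d = 0 ->
  (forall t, c < t < d -> is_derive q t (m t * k t)) ->
  (forall s t, c < s < d -> c < t < d -> 0 < m s * m t) ->
  (forall s t, c < s -> s < t -> t < d -> k t < k s) ->
  forall t, c < t < d -> 0 < m t * q t.
Proof.
  intros Hq Hc Hd HD Hm Hk t Ht.
  destruct (mean_value q (fun s => m s * k s) c t) as [s1 [S1 E1]];
    [lra|exact Hq|intros; apply HD; lra|].
  destruct (mean_value q (fun s => m s * k s) t d) as [s2 [S2 E2]];
    [lra|exact Hq|intros; apply HD; lra|].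
  pose proof (Hk s1 s2 ltac:(lra) ltac:(lra) ltac:(lra)) as K.
  pose proof (Hm s1 t ltac:(lra) ltac:(lra)) as M1.
  pose proof (Hm s2 t ltac:(lra) ltac:(lra)) as M2.
  assert (F1 : m t * q t = (m s1 * m t) * (t - c) * k s1)
    by (replace (q t) with (m s1 * k s1 * (t - c)) by lra; ring).
  assert (F2 : m t * q t = - ((m s2 * m t) * (d - t) * k s2))
    by (replace (q t) with (- (m s2 * k s2 * (d - t))) by lra; ring).
  destruct (Rlt_dec 0 (k s1)) as [P|P].
  - rewrite F1; apply Rmult_lt_0_compat; [|exact P].
    apply Rmult_lt_0_compat; lra.
  - rewrite F2; assert (0 < m s2 * m t * (d - t)) by (apply Rmult_lt_0_compat; lra).
    nra.
Qed.

Lemma decreasing_of_negative_derivative (f f' : R -> R) (c d : R) :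
  (forall t, c < t < d -> is_derive f t (f' t)) ->
  (forall t, c < t < d -> f' t < 0) ->
  forall s t, c < s -> s < t -> t < d -> f t < f s.
Proof.
  intros HD Hn s t Hs Hst Ht.
  destruct (MVT_cor2 f f' s t Hst) as [x [E Hx]].
  - intros x Hx; apply is_derive_Reals, HD; lra.
  - pose proof (Hn x ltac:(lra)); nra.
Qed.

(** * Picard iteration *)

Definition clamp (a b t : R) : R := Rmax a (Rmin t b).

Lemma clamp_range (a b t : R) : a <= b -> a <= clamp a b t <= b.
Proof.
  intro H; unfold clamp, Rmax, Rmin.
  destruct (Rle_dec t b); destruct (Rle_dec a _); lra.
Qed.

Lemma clamp_id (a b t : R) : a <= t <= b -> clamp a b t = t.
Proof.
  intro H; unfold clamp, Rmax, Rmin.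
  destruct (Rle_dec t b); destruct (Rle_dec a _); lra.
Qed.

Lemma clamp_lipschitz (a b s t : R) :
  Rabs (clamp a b s - clamp a b t) <= Rabs (s - t).
Proof.
  unfold clamp, Rmax, Rmin.
  destruct (Rle_dec s b); destruct (Rle_dec t b);
    repeat destruct (Rle_dec a _);
    unfold Rabs; repeat destruct (Rcase_abs _); lra.
Qed.

Lemma cont_of_eps (f : R -> R) :
  (forall t e, 0 < e -> exists d, 0 < d /\
     forall s, Rabs (s - t) < d -> Rabs (f s - f t) < e) -> cont f.
Proof.
  intros H t; apply filterlim_locally; intros [e He].
  destruct (H t e He) as [d [Hd K]].
  exists (mkposreal d Hd); intros s Hs; exact (K s Hs).
Qed.

Lemma cont_eps (f : R -> R) (t e : R) :
  cont f -> 0 < e -> exists d, 0 < d /\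
     forall s, Rabs (s - t) < d -> Rabs (f s - f t) < e.
Proof.
  intros H He.
  destruct (proj1 (filterlim_locally f (f t)) (H t) (mkposreal e He)) as [[d Hd] K].
  exists d; split; [exact Hd|]; intros s Hs; exact (K s Hs).
Qed.

Lemma cont_clamp (a b : R) : cont (clamp a b).
Proof.
  apply cont_of_eps; intros t e He; exists e; split; [exact He|].
  intros s Hs; pose proof (clamp_lipschitz a b s t); lra.
Qed.

Lemma geometric_small (C e : R) :
  0 < e -> exists N, forall n, (N <= n)%nat -> C * (1/2) ^ n < e.
Proof.
  intro He.
  destruct (pow_lt_1_zero (1/2) ltac:(rewrite Rabs_pos_eq; lra) (e / (Rabs C + 1)))
    as [N HN].
  { apply Rdiv_lt_0_compat; [exact He|pose proof (Rabs_pos C); lra]. }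
  exists N; intros n Hn; specialize (HN n Hn).
  pose proof (Rabs_pos C) as HC; pose proof (Rle_abs C) as HC'.
  assert (P : 0 < (1/2) ^ n) by (apply pow_lt; lra).
  rewrite Rabs_pos_eq in HN by lra.
  apply Rle_lt_trans with ((Rabs C + 1) * (1/2) ^ n).
  - apply Rmult_le_compat_r; lra.
  - apply Rmult_lt_compat_l with (r := Rabs C + 1) in HN; [|lra].
    replace ((Rabs C + 1) * (e / (Rabs C + 1))) with e in HN by (field; lra).
    exact HN.
Qed.

Lemma eq_of_geometric_bound (x y C : R) :
  (forall n, Rabs (x - y) <= C * (1/2) ^ n) -> x = y.
Proof.
  intro H; destruct (Req_dec x y) as [|N]; [assumption|exfalso].
  assert (P : 0 < Rabs (x - y)) by (apply Rabs_pos_lt; lra).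
  destruct (geometric_small C _ P) as [n Hn].
  specialize (Hn n (le_n n)); specialize (H n); lra.
Qed.

Lemma RInt_diff_le (f g : R -> R) (t K : R) :
  0 <= t -> cont f -> cont g ->
  (forall s, 0 <= s <= t -> Rabs (f s - g s) <= K) ->
  Rabs (RInt f 0 t - RInt g 0 t) <= t * K.
Proof.
  intros Ht Hf Hg H.
  pose proof (cont_RInt_integrable f 0 t Hf) as If.
  pose proof (cont_RInt_integrable g 0 t Hg) as Ig.
  pose proof (RInt_minus f g 0 t If Ig) as E.
  change (RInt (fun s => f s - g s) 0 t = RInt f 0 t - RInt g 0 t) in E.
  rewrite <- E; replace (t * K) with ((t - 0) * K) by ring.
  apply abs_RInt_le_const; [exact Ht| |exact H].
  exact (ex_RInt_minus f g 0 t If Ig).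
Qed.

(** The smallness [L * T <= 1/2] makes a single Picard step a contraction in the
    supremum norm. *)
Lemma picard (f : R -> R -> R) (T L y0 : R) :
  0 <= T -> 0 <= L -> L * T <= 1/2 ->
  (forall y, cont y -> cont (fun t => f t (y t))) ->
  (forall t a b, 0 <= t <= T -> Rabs (f t a - f t b) <= L * Rabs (a - b)) ->
  exists y, cont y /\
    forall t, 0 <= t <= T -> y t = y0 + RInt (fun s => f s (y s)) 0 t.
Proof.
  intros HT HL HLT Hcf Hlip.
  (* The upper bound of the integral is clamped, so that the iterates are defined
     and the estimates hold on the whole line. *)
  set (Phi := fun (y : R -> R) t => y0 + RInt (fun s => f s (y s)) 0 (clamp 0 T t)).
  assert (Phi_cont : forall y, cont y -> cont (Phi y)).
  { intros y Hy; unfold Phi; apply cont_plus; [apply cont_const|].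
    apply (cont_comp (fun t => RInt (fun s => f s (y s)) 0 t) (clamp 0 T)).
    - apply cont_RInt, Hcf, Hy.
    - apply cont_clamp. }
  assert (contraction : forall y z K, cont y -> cont z ->
    (forall t, Rabs (y t - z t) <= K) -> forall t, Rabs (Phi y t - Phi z t) <= K / 2).
  { intros y z K Hy Hz HK t; unfold Phi.
    destruct (clamp_range 0 T t HT) as [R1 R2].
    match goal with |- Rabs (?p + ?a - (?p + ?b)) <= _ =>
      replace (p + a - (p + b)) with (a - b) by ring end.
    assert (K0 : 0 <= K) by (pose proof (HK 0); pose proof (Rabs_pos (y 0 - z 0)); lra).
    apply Rle_trans with (clamp 0 T t * (L * K)).
    - apply RInt_diff_le; [exact R1|now apply Hcf|now apply Hcf|].
      intros s Hs; apply Rle_trans with (L * Rabs (y s - z s)).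
      + apply Hlip; lra.
      + apply Rmult_le_compat_l; [exact HL|apply HK].
    - apply Rle_trans with (T * (L * K)).
      + apply Rmult_le_compat_r; [apply Rmult_le_pos; lra|exact R2].
      + replace (T * (L * K)) with ((L * T) * K) by ring; nra. }
  set (g := fix g (n : nat) : R -> R :=
         match n with O => fun _ => y0 | S m => Phi (g m) end).
  assert (g_cont : forall n, cont (g n)).
  { induction n as [|n IH]; simpl; [apply cont_const|now apply Phi_cont]. }
  assert (start : exists K0, 0 < K0 /\ forall t, Rabs (g 1%nat t - g 0%nat t) <= K0).
  { destruct (cont_bounded (fun t => RInt (fun s => f s y0) 0 t) 0 T) as [K0 [P HK]].
    - apply cont_RInt, (Hcf (fun _ => y0)), cont_const.
    - exists K0; split; [exact P|]; intro t; simpl; unfold Phi.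
      rewrite Rplus_minus_l.
      apply HK, clamp_range, HT. }
  destruct start as [K0 [PK0 HK0]].
  assert (step : forall n t, Rabs (g (S n) t - g n t) <= K0 * (1/2) ^ n).
  { induction n as [|n IH]; intro t.
    - rewrite pow_O, Rmult_1_r; apply HK0.
    - replace (K0 * (1/2) ^ S n) with (K0 * (1/2) ^ n / 2) by (simpl; field).
      change (Rabs (Phi (g (S n)) t - Phi (g n) t) <= K0 * (1/2) ^ n / 2).
      now apply contraction. }
  assert (tail : forall n k t,
    Rabs (g (n + k)%nat t - g n t) <= 2 * K0 * (1/2) ^ n * (1 - (1/2) ^ k)).
  { intros n k t; induction k as [|k IH].
    - rewrite Nat.add_0_r, Rminus_diag, Rabs_R0; simpl; lra.
    - replace (n + S k)%nat with (S (n + k)) by lia.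
      pose proof (step (n + k)%nat t) as S1; rewrite pow_add in S1.
      pose proof (Rabs_triang (g (S (n + k)) t - g (n + k)%nat t)
                    (g (n + k)%nat t - g n t)) as Tr.
      replace (g (S (n + k)) t - g (n + k)%nat t + (g (n + k)%nat t - g n t))
        with (g (S (n + k)) t - g n t) in Tr by ring.
      change ((1/2) ^ S k) with (1/2 * (1/2) ^ k); lra. }
  assert (tail' : forall n m t, (n <= m)%nat ->
    Rabs (g m t - g n t) <= 2 * K0 * (1/2) ^ n).
  { intros n m t Hnm; replace m with (n + (m - n))%nat by lia.
    eapply Rle_trans; [apply tail|].
    assert (0 < (1/2) ^ n) by (apply pow_lt; lra).
    assert (0 < (1/2) ^ (m - n)) by (apply pow_lt; lra).
    assert (0 <= 2 * K0 * (1/2) ^ n) by nra.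
    nra. }
  set (y := fun t => real (Lim_seq (fun n => g n t))).
  assert (lim : forall t, is_lim_seq (fun n => g n t) (y t)).
  { intro t; apply Lim_seq_correct', ex_lim_seq_cauchy_corr; intros [e He]; simpl.
    destruct (geometric_small (4 * K0) e He) as [N HN].
    exists N; intros n m Hn Hm.
    pose proof (tail' N n t Hn) as T1; pose proof (tail' N m t Hm) as T2.
    specialize (HN N (le_n N)).
    rewrite Rabs_minus_sym in T2.
    pose proof (Rabs_triang (g n t - g N t) (g N t - g m t)) as Tr.
    replace (g n t - g N t + (g N t - g m t)) with (g n t - g m t) in Tr by ring.
    lra. }
  assert (unif : forall n t, Rabs (y t - g n t) <= 2 * K0 * (1/2) ^ n).
  { intros n t.
    assert (L1 : is_lim_seq (fun m => Rabs (g (m + n)%nat t - g n t))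
                   (Rabs (y t - g n t))).
    { apply (is_lim_seq_abs _ (y t - g n t)), is_lim_seq_minus'.
      - apply (is_lim_seq_incr_n (fun m => g m t)), lim.
      - apply is_lim_seq_const. }
    apply (is_lim_seq_le _ (fun _ => 2 * K0 * (1/2) ^ n) _ _
             (fun m => tail' n (m + n)%nat t ltac:(lia)) L1 (is_lim_seq_const _)). }
  assert (y_cont : cont y).
  { apply cont_of_eps; intros t e He.
    destruct (geometric_small (2 * K0) (e / 3) ltac:(lra)) as [N HN].
    specialize (HN N (le_n N)).
    destruct (cont_eps (g N) t (e / 3) (g_cont N) ltac:(lra)) as [d [Hd Hs]].
    exists d; split; [exact Hd|]; intros s Hst; specialize (Hs s Hst).
    pose proof (unif N s) as U1; pose proof (unif N t) as U2.
    apply Rabs_def1; apply Rabs_def2 in Hs;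
      apply Rabs_le_between in U1, U2; lra. }
  exists y; split; [exact y_cont|]; intros t Ht.
  replace (y0 + RInt (fun s => f s (y s)) 0 t) with (Phi y t)
    by (unfold Phi; now rewrite clamp_id).
  apply (eq_of_geometric_bound _ _ (2 * K0)); intro n.
  pose proof (unif (S n) t) as U.
  pose proof (contraction y (g n) _ y_cont (g_cont n) (unif n) t) as C.
  change (Phi (g n) t) with (g (S n) t) in C.
  rewrite <- tech_pow_Rmult in U.
  apply Rabs_le_between in U, C; apply Rabs_le_between; lra.
Qed.

(** * One-sided derivatives and extension by constants *)

(** Identifies the base point in the definition of [filterdiff] for a traced
    neighbourhood filter. *)
Lemma trace_filter_lim (D : R -> Prop) (t x : R) :
  D t -> is_filter_lim (within D (locally t)) x -> x = t.
Proof.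
  intros Ht Hx; destruct (Req_dec x t) as [|N]; [assumption|exfalso].
  assert (P : 0 < Rabs (t - x)) by (apply Rabs_pos_lt; lra).
  specialize (Hx (fun y => Rabs (y - x) < Rabs (t - x))).
  assert (L : locally x (fun y => Rabs (y - x) < Rabs (t - x)))
    by (exists (mkposreal _ P); intros y Hy; exact Hy).
  pose proof (locally_singleton _ _ (Hx L) Ht) as Q; simpl in Q; lra.
Qed.

Lemma is_derive_on_of_is_derive (D : R -> Prop) (f : R -> R) (t l : R) :
  D t -> is_derive f t l -> is_derive_on D f t l.
Proof.
  intros Ht [Hl Hd]; split; [exact Hl|]; intros x Hx.
  rewrite (trace_filter_lim D t x Ht Hx); intro eps.
  apply (filter_le_within D), (Hd t (fun P HP => HP)).
Qed.

Lemma is_derive_of_is_derive_on (D : R -> Prop) (f : R -> R) (t l : R) :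
  locally t D -> is_derive_on D f t l -> is_derive f t l.
Proof.
  intros Ht [Hl Hd]; split; [exact Hl|]; intros x Hx eps.
  assert (Hx' : is_filter_lim (within D (locally t)) x)
    by (intros P HP; apply (filter_le_within D), Hx, HP).
  apply (filter_imp (fun y => (D y -> norm (minus (minus (f y) (f x))
      (scal (minus y x) l)) <= eps * norm (minus y x)) /\ D y)).
  - intros y [H1 H2]; exact (H1 H2).
  - apply filter_and; [exact (Hd x Hx' eps)|exact Ht].
Qed.

Lemma is_derive_on_ext (D : R -> Prop) (f g : R -> R) (t l : R) :
  (forall s, D s -> f s = g s) -> D t ->
  is_derive_on D f t l -> is_derive_on D g t l.
Proof.
  intros E Ht H; unfold is_derive_on.
  apply (filterdiff_ext_loc f g); [|intros x Hx|exact H].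
  - exact (filter_forall (F := locally t) (fun s => D s -> f s = g s) E).
  - rewrite (trace_filter_lim D t x Ht Hx); now apply E.
Qed.

Lemma Icc_locally (a b t : R) : a < t < b -> locally t (Icc a b).
Proof.
  intro H; assert (P : 0 < Rmin (t - a) (b - t)) by (apply Rmin_pos; lra).
  exists (mkposreal _ P); intros y Hy.
  apply Rabs_def2 in Hy; simpl in Hy.
  pose proof (Rmin_l (t - a) (b - t)); pose proof (Rmin_r (t - a) (b - t)).
  unfold Icc, minus, plus, opp in *; simpl in *; lra.
Qed.

Lemma is_derive_on_interior (a b : R) (f : R -> R) (t l : R) :
  a < t < b -> is_derive_on (Icc a b) f t l -> is_derive f t l.
Proof. intro H; apply is_derive_of_is_derive_on, Icc_locally, H. Qed.

Lemma Derive_on_interior (a b : R) (f : R -> R) (t : R) :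
  a < t < b -> ex_derive_on (Icc a b) f t ->
  is_derive f t (Derive_on (Icc a b) f t).
Proof.
  intros H [l Hl]; apply (is_derive_on_interior a b f t _ H).
  unfold Derive_on.
  rewrite (iota_unique (V := R_CompleteNormedModule) _ l); [exact Hl| |exact Hl].
  intros m Hm.
  rewrite <- (is_derive_unique f t m (is_derive_on_interior a b f t m H Hm)).
  exact (is_derive_unique f t l (is_derive_on_interior a b f t l H Hl)).
Qed.

Lemma cont_extension (a b : R) (f : R -> R) :
  a <= b -> (forall t, Icc a b t -> ex_derive_on (Icc a b) f t) ->
  cont (fun t => f (clamp a b t)).
Proof.
  intros Hab H t.
  pose proof (clamp_range a b t Hab) as R.
  assert (L : filterlim f (within (Icc a b) (locally (clamp a b t)))
                (locally (f (clamp a b t)))).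
  { apply (filterdiff_continuous_aux (K := R_AbsRing) (U := R_NormedModule)
             (V := R_NormedModule)).
    - destruct (H _ R) as [l Hl]; exists (fun y => scal y l); exact Hl.
    - intros P HP; now apply filter_le_within. }
  refine (filterlim_comp _ _ _ (clamp a b) f _ _ _ _ L).
  intros P HP.
  pose proof (cont_clamp a b t _ HP) as Q.
  apply (filter_imp _ _ (fun s HQ => HQ (clamp_range a b s Hab)) Q).
Qed.

Lemma is_derive_extension (a b : R) (f : R -> R) (t l : R) :
  a < t < b -> is_derive f t l -> is_derive (fun s => f (clamp a b s)) t l.
Proof.
  intros H; apply is_derive_ext_loc.
  apply (filter_imp (Icc a b)); [|now apply Icc_locally].
  intros s Hs; symmetry; f_equal; now apply clamp_id.
Qed.

Lemma is_derive_of_quadratic_remainder (f : R -> R) (x l d C : R) :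
  0 < d -> 0 < C ->
  (forall h, Rabs h < d -> Rabs (f (x + h) - f x - h * l) <= C * h ^ 2) ->
  is_derive f x l.
Proof.
  intros Hd HC H; apply is_derive_Reals; intros e He.
  assert (P : 0 < Rmin d (e / C)) by (apply Rmin_pos; [|apply Rdiv_lt_0_compat]; lra).
  exists (mkposreal _ P); intros h Hh Hs; simpl in Hs.
  pose proof (Rmin_l d (e / C)); pose proof (Rmin_r d (e / C)).
  specialize (H h ltac:(lra)).
  replace ((f (x + h) - f x) / h - l) with ((f (x + h) - f x - h * l) / h)
    by (field; exact Hh).
  unfold Rdiv; rewrite Rabs_mult, Rabs_inv.
  assert (Ph : 0 < Rabs h) by now apply Rabs_pos_lt.
  apply Rmult_lt_reg_r with (Rabs h); [exact Ph|].
  rewrite Rmult_assoc, Rinv_l, Rmult_1_r by lra.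
  eapply Rle_lt_trans; [exact H|].
  rewrite <- pow2_abs.
  assert (C * Rabs h < e).
  { apply Rmult_lt_reg_r with (/ C); [now apply Rinv_0_lt_compat|].
    replace (C * Rabs h * / C) with (Rabs h) by (field; lra).
    change (Rabs h < e / C); lra. }
  simpl; nra.
Qed.

(** * Solutions of the Abel equation *)

(** Continuity on the whole line together with the equation on the open interval
    characterises the constant extensions of solutions on [0, T], and keeps
    one-sided derivatives out of the arguments below. *)
Definition interior_solution (A B : R -> R) (T x : R) (y : R -> R) : Prop :=
  cont y /\ y 0 = x /\
  forall t, 0 < t < T -> is_derive y t (A t * y t ^ 3 + B t * y t ^ 2).

(** The difference of two solutions solves a linear equation. *)
Lemma interior_solution_unique (A B : R -> R) (T x : R) (y z : R -> R) :
  cont A -> cont B ->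
  interior_solution A B T x y -> interior_solution A B T x z ->
  forall t, 0 <= t <= T -> y t = z t.
Proof.
  intros HA HB [Cy [Iy Dy]] [Cz [Iz Dz]] t Ht.
  set (c := fun t => A t * (y t ^ 2 + y t * z t + z t ^ 2) + B t * (y t + z t)).
  assert (E : y t + -1 * z t = (y 0 + -1 * z 0) * exp (RInt c 0 t)).
  { apply (linear_solution c (fun t => y t + -1 * z t) T).
    - unfold c; cont_tac.
    - cont_tac.
    - intros s Hs; pose proof (Dy s Hs) as D1; pose proof (Dz s Hs) as D2.
      unfold c; derive_tac.
    - exact Ht. }
  rewrite Iy, Iz in E; replace (x + -1 * x) with 0 in E by ring; lra.
Qed.

Lemma solution_integral_equation (A B : R -> R) (T x : R) (y : R -> R) :
  cont A -> cont B -> interior_solution A B T x y ->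
  forall t, 0 <= t <= T ->
    y t = x + RInt (fun s => A s * y s ^ 3 + B s * y s ^ 2) 0 t.
Proof.
  intros HA HB [Cy [Iy Dy]] t Ht.
  set (F := fun s => A s * y s ^ 3 + B s * y s ^ 2).
  assert (CF : cont F) by (unfold F; cont_tac).
  assert (E : y t + -1 * RInt F 0 t = y 0 + -1 * RInt F 0 0).
  { apply (constant_of_zero_derivative (fun t => y t + -1 * RInt F 0 t) 0 T);
      [cont_tac| |exact Ht].
    intros s Hs; pose proof (Dy s Hs) as D1; pose proof (RInt_is_derive F s CF) as D2.
    fold (F s) in D1; derive_tac. }
  rewrite RInt_point, Iy in E; change (@zero R_CompleteNormedModule) with 0 in E.
  lra.
Qed.

Lemma interior_solution_of_abel (A B : R -> R) (T x : R) (y : R -> R) :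
  0 < T -> abel_solution A B T x y ->
  interior_solution (fun t => A (clamp 0 T t)) (fun t => B (clamp 0 T t)) T x
    (fun t => y (clamp 0 T t)).
Proof.
  intros HT [Iy Dy]; split; [|split].
  - apply cont_extension; [lra|]; intros t Ht; eexists; now apply Dy.
  - now rewrite clamp_id by lra.
  - intros t Ht; rewrite clamp_id by lra; apply is_derive_extension; [exact Ht|].
    apply (is_derive_on_interior 0 T); [exact Ht|]; apply Dy; unfold Icc; lra.
Qed.

(** The integral equation recovers the one-sided derivatives at the end points. *)
Lemma abel_of_interior_solution (A B : R -> R) (T x : R) (y : R -> R) :
  0 < T -> cont (fun t => A (clamp 0 T t)) -> cont (fun t => B (clamp 0 T t)) ->
  interior_solution (fun t => A (clamp 0 T t)) (fun t => B (clamp 0 T t)) T x y ->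
  abel_solution A B T x y.
Proof.
  intros HT HA HB Hy; split; [apply Hy|]; intros t Ht.
  pose proof (solution_integral_equation _ _ T x y HA HB Hy) as E.
  set (F := fun s => A (clamp 0 T s) * y s ^ 3 + B (clamp 0 T s) * y s ^ 2) in *.
  assert (CF : cont F) by (unfold F; destruct Hy; cont_tac).
  apply (is_derive_on_ext _ (fun t => x + RInt F 0 t)).
  - intros s Hs; symmetry; now apply E.
  - exact Ht.
  - replace (A t * y t ^ 3 + B t * y t ^ 2) with (F t)
      by (unfold F; now rewrite clamp_id).
    apply is_derive_on_of_is_derive; [exact Ht|].
    pose proof (RInt_is_derive F t CF) as D; derive_tac.
Qed.

(** On the ball of radius r = 2|h| the right-hand side A e^3 + B e^2 has size
    O(r^2) and Lipschitz constant O(r), so for small [h] the Picard map contracts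
    and its fixed point stays within |h| of [h]. The iteration is run with the
    right-hand side truncated to that ball, and the bound on the fixed point shows
    that the truncation is inactive. *)
Lemma abel_small_solutions (A B : R -> R) (T : R) :
  0 < T -> cont A -> cont B ->
  exists d C, 0 < d /\ 0 < C /\ forall h, Rabs h < d ->
    exists e, interior_solution A B T h e /\
      forall t, 0 <= t <= T -> Rabs (e t - h) <= C * h ^ 2.
Proof.
  intros HT HA HB.
  destruct (cont_bounded A 0 T HA) as [M1 [PM1 HM1]].
  destruct (cont_bounded B 0 T HB) as [M2 [PM2 HM2]].
  set (M := M1 + M2).
  assert (PM : 0 < M) by (unfold M; lra).
  assert (PMT : 0 < M * T) by nra.
  (* The radius makes 5 M r T <= 1/2 (contraction) and 8 M T |h| <= 1 (inactive
     truncation) for r = 2|h|. *)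
  exists (/ (20 * (M * T + 1))), (8 * (M * T)); split; [|split].
  { apply Rinv_0_lt_compat; lra. }
  { lra. }
  intros h Hh.
  assert (Sh : 20 * (M * T + 1) * Rabs h < 1).
  { apply Rmult_lt_compat_l with (r := 20 * (M * T + 1)) in Hh; [|lra].
    rewrite Rinv_r in Hh; lra. }
  set (r := 2 * Rabs h).
  pose proof (Rabs_pos h) as Ph.
  assert (Hr1 : 0 <= r <= 1) by (unfold r; split; nra).
  assert (cl : forall a, Rabs (clamp (- r) r a) <= r).
  { intro a; apply Rabs_le, clamp_range; lra. }
  set (f := fun t a => A t * clamp (- r) r a ^ 3 + B t * clamp (- r) r a ^ 2).
  assert (f_bound : forall t a, 0 <= t <= T -> Rabs (f t a) <= M * r ^ 2).
  { intros t a Ht; unfold f; specialize (HM1 t Ht); specialize (HM2 t Ht).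
    specialize (cl a); set (b := clamp (- r) r a) in *.
    replace (A t * b ^ 3 + B t * b ^ 2) with ((A t * b + B t) * b ^ 2) by ring.
    rewrite Rabs_mult, <- RPow_abs.
    apply Rmult_le_compat; [apply Rabs_pos|apply pow_le, Rabs_pos| |].
    - eapply Rle_trans; [apply Rabs_triang|]; rewrite Rabs_mult.
      pose proof (Rabs_pos (A t)); pose proof (Rabs_pos b); unfold M; nra.
    - apply pow_incr; split; [apply Rabs_pos|exact cl]. }
  destruct (picard f T (5 * M * r) h) as [e [Ce Ee]].
  - lra.
  - apply Rmult_le_pos; lra.
  - unfold r; nra.
  - intros y Hy; unfold f.
    assert (cont (fun t => clamp (- r) r (y t)))
      by (apply (cont_comp (clamp (- r) r) y); [apply cont_clamp|exact Hy]).
    cont_tac.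
  - intros t a b Ht; unfold f; specialize (HM1 t Ht); specialize (HM2 t Ht).
    pose proof (clamp_lipschitz (- r) r a b) as Lip.
    pose proof (cl a) as Ca; pose proof (cl b) as Cb.
    set (a' := clamp (- r) r a) in *; set (b' := clamp (- r) r b) in *.
    replace (A t * a' ^ 3 + B t * a' ^ 2 - (A t * b' ^ 3 + B t * b' ^ 2))
      with ((A t * (a' * a' + a' * b' + b' * b') + B t * (a' + b')) * (a' - b')) by ring.
    rewrite Rabs_mult.
    apply Rmult_le_compat; [apply Rabs_pos|apply Rabs_pos| |exact Lip].
    assert (Q1 : Rabs (a' + b') <= 2 * r)
      by (eapply Rle_trans; [apply Rabs_triang|]; lra).
    assert (Q2 : Rabs (a' * a' + a' * b' + b' * b') <= 3 * r).
    { assert (P : forall x y, Rabs x <= r -> Rabs y <= r -> Rabs (x * y) <= r).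
      { intros x y Hx Hy; rewrite Rabs_mult.
        pose proof (Rabs_pos x); pose proof (Rabs_pos y); nra. }
      pose proof (P a' a' Ca Ca); pose proof (P a' b' Ca Cb); pose proof (P b' b' Cb Cb).
      eapply Rle_trans; [apply Rabs_triang|].
      eapply Rle_trans; [apply Rplus_le_compat_r, Rabs_triang|]; lra. }
    eapply Rle_trans; [apply Rabs_triang|]; rewrite !Rabs_mult.
    pose proof (Rabs_pos (A t)); pose proof (Rabs_pos (B t)).
    pose proof (Rabs_pos (a' + b')); pose proof (Rabs_pos (a' * a' + a' * b' + b' * b')).
    assert (Rabs (A t) * Rabs (a' * a' + a' * b' + b' * b') <= M1 * (3 * r))
      by (apply Rmult_le_compat; lra).
    assert (Rabs (B t) * Rabs (a' + b') <= M2 * (2 * r))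
      by (apply Rmult_le_compat; lra).
    unfold M; nra.
  - assert (Cf : cont (fun s => f s (e s))).
    { assert (cont (fun t => clamp (- r) r (e t)))
        by (apply (cont_comp (clamp (- r) r) e); [apply cont_clamp|exact Ce]).
      unfold f; cont_tac. }
    assert (near : forall t, 0 <= t <= T -> Rabs (e t - h) <= 8 * (M * T) * h ^ 2).
    { intros t Ht; rewrite (Ee t Ht), Rplus_minus_l.
      apply Rle_trans with ((t - 0) * (M * r ^ 2)).
      - apply abs_RInt_le_const; [lra|now apply cont_RInt_integrable|].
        intros s Hs; apply f_bound; lra.
      - unfold r; rewrite Rpow_mult_distr, pow2_abs.
        assert (0 <= M * h ^ 2) by (pose proof (pow2_ge_0 h); nra).
        nra. }
    assert (untruncated : forall t, 0 <= t <= T -> clamp (- r) r (e t) = e t).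
    { intros t Ht; apply clamp_id; specialize (near t Ht).
      rewrite <- pow2_abs in near.
      assert (8 * (M * T) * Rabs h ^ 2 <= Rabs h) by (simpl; nra).
      assert (K : Rabs (e t - h) <= Rabs h) by lra.
      apply Rabs_le_between in K; pose proof (Rabs_le_between h (Rabs h)) as [K' _].
      specialize (K' (Rle_refl _)); unfold r; lra. }
    exists e; split; [split; [exact Ce|split]|exact near].
    + rewrite (Ee 0 ltac:(lra)), RInt_point.
      change (@zero R_CompleteNormedModule) with 0; ring.
    + intros t Ht.
      apply (is_derive_ext_loc (fun t => h + RInt (fun s => f s (e s)) 0 t)).
      * apply (filter_imp (Icc 0 T)); [|now apply Icc_locally].
        intros s Hs; symmetry; now apply Ee.
      * pose proof (RInt_is_derive _ t Cf) as D.
        unfold f in D at 2; rewrite untruncated in D by lra; derive_tac.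
Qed.

(** * Dependence on the initial value *)

(** The solution of the variational equation along [y] with initial value 1. *)
Definition variation (A B y : R -> R) (t : R) : R :=
  exp (RInt (fun s => 3 * A s * y s ^ 2 + 2 * B s * y s) 0 t).

Lemma cont_variation (A B y : R -> R) :
  cont A -> cont B -> cont y -> cont (variation A B y).
Proof. intros; unfold variation; cont_tac. Qed.

Lemma is_derive_variation (A B y : R -> R) (t : R) :
  cont A -> cont B -> cont y ->
  is_derive (variation A B y) t
    ((3 * A t * y t ^ 2 + 2 * B t * y t) * variation A B y t).
Proof.
  intros HA HB Hy.
  assert (C : cont (fun s => 3 * A s * y s ^ 2 + 2 * B s * y s)) by cont_tac.
  pose proof (RInt_is_derive _ t C) as D; exact (is_derive_exp_comp _ _ _ D).
Qed.

Lemma variation_0 (A B y : R -> R) : variation A B y 0 = 1.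
Proof. unfold variation; rewrite RInt_point; exact exp_0. Qed.

(** The substitution z = y + p e, with [p] the variation along [y], removes the
    linear term of the equation for z - y, which reduces the existence of nearby
    solutions and their expansion to the small solutions of another Abel
    equation. *)
Lemma nearby_solutions (A B : R -> R) (T x : R) (y : R -> R) :
  0 < T -> cont A -> cont B -> interior_solution A B T x y ->
  exists d C, 0 < d /\ 0 < C /\ forall h, Rabs h < d ->
    exists z, interior_solution A B T (x + h) z /\
      forall t, 0 <= t <= T ->
        Rabs (z t - y t - h * variation A B y t) <= C * h ^ 2.
Proof.
  intros HT HA HB [Cy [Iy Dy]].
  set (p := variation A B y).
  assert (Cp : cont p) by now apply cont_variation.
  set (alpha := fun t => p t * (3 * A t * y t + B t)).
  set (beta := fun t => p t ^ 2 * A t).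
  destruct (abel_small_solutions beta alpha T HT) as [d [C [Pd [PC H]]]];
    [unfold beta; cont_tac|unfold alpha; cont_tac|].
  destruct (cont_bounded p 0 T Cp) as [M [PM HM]].
  exists d, (M * C); split; [exact Pd|split; [now apply Rmult_lt_0_compat|]].
  intros h Hh; destruct (H h Hh) as [e [[Ce [Ie De]] Ee]].
  exists (fun t => y t + p t * e t); split; [split; [cont_tac|split]|].
  - unfold p; rewrite variation_0, Iy, Ie; ring.
  - intros t Ht; pose proof (Dy t Ht) as D1; pose proof (De t Ht) as D2.
    assert (D3 : is_derive p t ((3 * A t * y t ^ 2 + 2 * B t * y t) * p t))
      by now apply is_derive_variation.
    unfold alpha, beta in D2; derive_tac.
  - intros t Ht.
    replace (y t + p t * e t - y t - h * p t) with (p t * (e t - h)) by ring.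
    rewrite Rabs_mult, Rmult_assoc.
    apply Rmult_le_compat; [apply Rabs_pos|apply Rabs_pos|now apply HM|now apply Ee].
Qed.

(** A selection of a solution for every initial value that admits one; for the
    other initial values [W x] is arbitrary. *)
Definition solution_family (A B : R -> R) (T : R) (W : R -> R -> R) : Prop :=
  forall x y, interior_solution A B T x y -> interior_solution A B T x (W x).

Lemma family_expansion (A B : R -> R) (T x : R) (W : R -> R -> R) :
  0 < T -> cont A -> cont B -> solution_family A B T W ->
  interior_solution A B T x (W x) ->
  exists d C, 0 < d /\ 0 < C /\ forall h, Rabs h < d ->
    interior_solution A B T (x + h) (W (x + h)) /\
    forall t, 0 <= t <= T ->
      Rabs (W (x + h) t - W x t - h * variation A B (W x) t) <= C * h ^ 2.
Proof.
  intros HT HA HB HW Hx.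
  destruct (nearby_solutions A B T x (W x) HT HA HB Hx) as [d [C [Pd [PC H]]]].
  exists d, C; split; [exact Pd|split; [exact PC|]]; intros h Hh.
  destruct (H h Hh) as [z [Hz Ez]].
  pose proof (HW _ _ Hz) as Hw; split; [exact Hw|]; intros t Ht.
  rewrite (interior_solution_unique A B T (x + h) _ _ HA HB Hw Hz t Ht).
  now apply Ez.
Qed.

Lemma family_derivative (A B : R -> R) (T x : R) (W : R -> R -> R) :
  0 < T -> cont A -> cont B -> solution_family A B T W ->
  interior_solution A B T x (W x) ->
  is_derive (fun z => W z T) x (variation A B (W x) T).
Proof.
  intros HT HA HB HW Hx.
  destruct (family_expansion A B T x W HT HA HB HW Hx) as [d [C [Pd [PC H]]]].
  apply (is_derive_of_quadratic_remainder _ _ _ d C Pd PC).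
  intros h Hh; apply (H h Hh); lra.
Qed.

(** Near [x] the first derivative is exp (G z), where G z is the integral of
    3 A W^2 + 2 B W along [W z]; the uniform expansion of [W] makes [G]
    differentiable at [x]. *)
Lemma family_second_derivative (A B : R -> R) (T x : R) (W : R -> R -> R) :
  0 < T -> cont A -> cont B -> solution_family A B T W ->
  interior_solution A B T x (W x) ->
  is_derive_n (fun z => W z T) 2 x
    (RInt (fun t => (6 * A t * W x t + 2 * B t) * variation A B (W x) t) 0 T
     * variation A B (W x) T).
Proof.
  intros HT HA HB HW Hx.
  destruct (family_expansion A B T x W HT HA HB HW Hx) as [d [C [Pd [PC H]]]].
  set (p := variation A B (W x)) in *.
  set (G := fun z => RInt (fun s => 3 * A s * W z s ^ 2 + 2 * B s * W z s) 0 T).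
  set (g := fun t => (6 * A t * W x t + 2 * B t) * p t).
  assert (Cx : cont (W x)) by apply Hx.
  assert (Cp : cont p) by now apply cont_variation.
  assert (Cg : cont g) by (unfold g; cont_tac).
  assert (DG : is_derive G x (RInt g 0 T)).
  { destruct (cont_bounded A 0 T HA) as [MA [PMA HMA]].
    destruct (cont_bounded B 0 T HB) as [MB [PMB HMB]].
    destruct (cont_bounded (W x) 0 T Cx) as [MW [PMW HMW]].
    destruct (cont_bounded p 0 T Cp) as [MP [PMP HMP]].
    set (K := 3 * MA * ((MP + C) ^ 2 + 2 * MW * C) + 2 * MB * C).
    assert (PK : 0 < K).
    { unfold K; pose proof (pow2_ge_0 (MP + C)).
      assert (0 < 2 * MW * C) by (apply Rmult_lt_0_compat; lra).
      assert (0 < 2 * MB * C) by (apply Rmult_lt_0_compat; lra).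
      nra. }
    apply (is_derive_of_quadratic_remainder G x _ (Rmin d 1) (T * K)).
    - apply Rmin_pos; lra.
    - nra.
    - intros h Hh; pose proof (Rmin_l d 1); pose proof (Rmin_r d 1).
      destruct (H h ltac:(lra)) as [[Cz _] Hz].
      set (z := W (x + h)) in *.
      set (f1 := fun s => 3 * A s * z s ^ 2 + 2 * B s * z s).
      set (f0 := fun s => 3 * A s * W x s ^ 2 + 2 * B s * W x s).
      assert (C1 : cont f1) by (unfold f1; cont_tac).
      assert (C0 : cont f0) by (unfold f0; cont_tac).
      assert (E : G x + h * RInt g 0 T = RInt (fun s => f0 s + h * g s) 0 T).
      { pose proof (cont_RInt_integrable f0 0 T C0) as I0.
        pose proof (cont_RInt_integrable g 0 T Cg) as Ig.
        pose proof (RInt_scal g 0 T h Ig) as E1.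
        change (RInt (fun s => h * g s) 0 T = h * RInt g 0 T) in E1.
        assert (Ig' : ex_RInt (fun s => h * g s) 0 T)
          by (apply cont_RInt_integrable; cont_tac).
        pose proof (RInt_plus f0 (fun s => h * g s) 0 T I0 Ig') as E2.
        change (RInt (fun s => f0 s + h * g s) 0 T
                = RInt f0 0 T + RInt (fun s => h * g s) 0 T) in E2.
        rewrite E2, E1; reflexivity. }
      replace (G (x + h) - G x - h * RInt g 0 T)
        with (G (x + h) - (G x + h * RInt g 0 T)) by ring.
      rewrite E, Rmult_assoc.
      change (Rabs (RInt f1 0 T - RInt (fun s => f0 s + h * g s) 0 T) <= T * (K * h ^ 2)).
      apply RInt_diff_le; [lra|exact C1|cont_tac|].
      intros s Hs; specialize (HMA s Hs); specialize (HMB s Hs);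
        specialize (HMW s Hs); specialize (HMP s Hs); specialize (Hz s Hs).
      unfold f1, f0, g.
      set (a := A s) in *; set (b := B s) in *; set (w := W x s) in *;
        set (q := p s) in *; set (v := z s) in *.
      (* The integrand of G x + h G'(x) cancels up to terms that are quadratic in
         v - w or linear in the remainder r. *)
      set (r := v - w - h * q) in *.
      replace v with (w + h * q + r) by (unfold r; ring).
      match goal with |- Rabs ?X <= _ =>
        replace X with (3 * a * ((h * q + r) ^ 2 + 2 * w * r) + 2 * b * r) by ring end.
      assert (Sh : h ^ 2 <= Rabs h).
      { rewrite <- pow2_abs; pose proof (Rabs_pos h); simpl; nra. }
      assert (B1 : Rabs (h * q + r) <= (MP + C) * Rabs h).
      { eapply Rle_trans; [apply Rabs_triang|]; rewrite Rabs_mult.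
        pose proof (Rabs_pos h); nra. }
      assert (B2 : Rabs ((h * q + r) ^ 2) <= (MP + C) ^ 2 * h ^ 2).
      { rewrite <- RPow_abs, <- (pow2_abs h), <- Rpow_mult_distr.
        apply pow_incr; split; [apply Rabs_pos|exact B1]. }
      assert (B3 : Rabs (2 * w * r) <= 2 * MW * C * h ^ 2).
      { rewrite !Rabs_mult, (Rabs_pos_eq 2) by lra.
        replace (2 * MW * C * h ^ 2) with ((2 * MW) * (C * h ^ 2)) by ring.
        pose proof (Rabs_pos w); pose proof (Rabs_pos r).
        apply Rmult_le_compat; lra. }
      assert (B4 : Rabs ((h * q + r) ^ 2 + 2 * w * r)
                   <= (MP + C) ^ 2 * h ^ 2 + 2 * MW * C * h ^ 2)
        by (eapply Rle_trans; [apply Rabs_triang|]; lra).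
      eapply Rle_trans; [apply Rabs_triang|].
      rewrite (Rabs_mult (3 * a)), (Rabs_mult (2 * b)), (Rabs_mult 3), (Rabs_mult 2),
        (Rabs_pos_eq 3), (Rabs_pos_eq 2) by lra.
      pose proof (Rabs_pos a); pose proof (Rabs_pos b); pose proof (Rabs_pos r).
      pose proof (Rabs_pos ((h * q + r) ^ 2 + 2 * w * r)).
      replace (K * h ^ 2)
        with (3 * MA * ((MP + C) ^ 2 * h ^ 2 + 2 * MW * C * h ^ 2) + 2 * MB * (C * h ^ 2))
        by (unfold K; ring).
      apply Rplus_le_compat; apply Rmult_le_compat; lra. }
  apply (is_derive_ext_loc (fun z => exp (G z))).
  - exists (mkposreal d Pd); intros z Hz; change (Rabs (z - x) < d) in Hz.
    destruct (H (z - x) Hz) as [Hz' _].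
    rewrite Rplus_minus in Hz'.
    symmetry; apply (is_derive_unique (fun z => W z T) z).
    now apply (family_derivative A B T z W).
  - exact (is_derive_exp_comp G x _ DG).
Qed.

(** * Convex loops *)

Lemma RInt_combination (f g : R -> R) (k l t : R) :
  cont f -> cont g ->
  RInt (fun s => k * f s + l * g s) 0 t = k * RInt f 0 t + l * RInt g 0 t.
Proof.
  intros Hf Hg.
  assert (S : forall (h : R -> R) (c : R), cont h ->
            RInt (fun s => c * h s) 0 t = c * RInt h 0 t).
  { intros h c Hh; exact (RInt_scal h 0 t c (cont_RInt_integrable h 0 t Hh)). }
  rewrite <- (S f k Hf), <- (S g l Hg).
  apply (RInt_plus (fun s => k * f s) (fun s => l * g s));
    apply cont_RInt_integrable; cont_tac.
Qed.

(** The curve (a, b) is a loop made of two arcs along which a is monotone and the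
    slope [g] of the curve is monotone, so each arc stays on one side of the chord
    of slope k = b(c)/a(c). The integral over the loop of the exact form
    e^((2+k)a) da is zero; after its subtraction the integrand has a constant
    sign. The factor [sg] treats both orientations at once. *)
Lemma exp_loop_integral_sign (a b m g : R -> R) (sg c T : R) :
  0 < c < T -> cont a -> cont b -> cont m ->
  (forall t, 0 < t < T -> is_derive a t (m t)) ->
  (forall t, 0 < t < T -> t <> c -> is_derive b t (m t * g t)) ->
  (forall t, 0 < t < T -> t <> c -> m t <> 0) ->
  (forall s t, 0 < s -> s < t -> t < c -> sg * g t < sg * g s) ->
  (forall s t, c < s -> s < t -> t < T -> sg * g t < sg * g s) ->
  a 0 = 0 -> b 0 = 0 -> a T = 0 -> b T = 0 ->
  0 < sg * RInt (fun t => m t * exp (2 * a t + b t)) 0 T.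
Proof.
  intros Hc Ca Cb Cm Da Db Nm G1 G2 a0 b0 aT bT.
  assert (Nc : a c <> 0).
  { destruct (mean_value a m 0 c) as [s [Hs E]]; [lra|exact Ca|intros; apply Da; lra|].
    rewrite a0 in E; pose proof (Nm s ltac:(lra) ltac:(lra)) as N.
    intro Z; rewrite Z in E.
    assert (0 <> m s * (c - 0)) by (apply not_eq_sym, Rmult_integral_contrapositive; lra).
    lra. }
  set (k := b c / a c).
  set (q := fun t => sg * (b t + - k * a t)).
  assert (Cq : cont q) by (unfold q; cont_tac).
  assert (Dq : forall t, 0 < t < T -> t <> c -> is_derive q t (m t * (sg * (g t - k)))).
  { intros t Ht Hn; pose proof (Da t Ht) as D1; pose proof (Db t Ht Hn) as D2.
    unfold q; derive_tac. }
  assert (q0 : q 0 = 0) by (unfold q; rewrite a0, b0; ring).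
  assert (qc : q c = 0) by (unfold q, k; field; exact Nc).
  assert (qT : q T = 0) by (unfold q; rewrite aT, bT; ring).
  assert (mq : forall t, 0 < t < T -> t <> c -> 0 < m t * q t).
  { intros t Ht Hn; destruct (Rlt_dec t c) as [L|L].
    - apply (arc_sign q m (fun t => sg * (g t - k)) 0 c); try assumption; [| | |lra].
      + intros s Hs; apply Dq; lra.
      + apply cont_sign_constant; [exact Cm|intros s Hs; apply Nm; lra].
      + intros s r H1 H2 H3; pose proof (G1 s r H1 H2 H3); lra.
    - apply (arc_sign q m (fun t => sg * (g t - k)) c T); try assumption; [| | |lra].
      + intros s Hs; apply Dq; lra.
      + apply cont_sign_constant; [exact Cm|intros s Hs; apply Nm; lra].
      + intros s r H1 H2 H3; pose proof (G2 s r H1 H2 H3); lra. }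
  set (f := fun t => m t * exp (2 * a t + b t)).
  set (e := fun s => exp ((2 + k) * s)).
  assert (Cf : cont f) by (unfold f; cont_tac).
  assert (Ce : cont e)
    by (apply (cont_exp (fun s => (2 + k) * s)), (cont_mult (fun _ => 2 + k) (fun s => s));
        [apply cont_const|intro; apply continuous_id]).
  (* The primitive is left as an integral because 2 + k may vanish. *)
  set (Psi := fun s => RInt e 0 s).
  set (W := fun t => sg * (RInt f 0 t + -1 * Psi (a t))).
  assert (DW : forall t, 0 < t < T -> is_derive W t (sg * (f t - m t * e (a t)))).
  { intros t Ht; pose proof (RInt_is_derive f t Cf) as D1.
    pose proof (is_derive_Rcomp Psi a t _ _ (RInt_is_derive e (a t) Ce) (Da t Ht)) as D2.
    unfold W; derive_tac. }
  assert (CW : cont W).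
  { unfold W; apply cont_mult; [apply cont_const|]; apply cont_plus; [now apply cont_RInt|].
    apply cont_mult; [apply cont_const|].
    apply (cont_comp Psi a); [now apply cont_RInt|exact Ca]. }
  assert (PW : forall t, 0 < t < T -> t <> c -> 0 < sg * (f t - m t * e (a t))).
  { intros t Ht Hn; specialize (mq t Ht Hn); unfold q in mq.
    unfold f, e; set (X := 2 * a t + b t); set (Y := (2 + k) * a t).
    replace (b t + - k * a t) with (X - Y) in mq by (unfold X, Y; ring).
    replace (sg * (m t * exp X - m t * exp Y)) with ((sg * m t) * (exp X - exp Y)) by ring.
    replace (m t * (sg * (X - Y))) with ((sg * m t) * (X - Y)) in mq by ring.
    destruct (Rtotal_order X Y) as [L|[L|L]].
    - pose proof (exp_increasing _ _ L); nra.
    - rewrite L in mq; lra.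
    - pose proof (exp_increasing _ _ L); nra. }
  destruct (mean_value W _ 0 c ltac:(lra) CW (fun t Ht => DW t ltac:(lra)))
    as [s1 [S1 E1]].
  destruct (mean_value W _ c T ltac:(lra) CW (fun t Ht => DW t ltac:(lra)))
    as [s2 [S2 E2]].
  pose proof (PW s1 ltac:(lra) ltac:(lra)) as P1.
  pose proof (PW s2 ltac:(lra) ltac:(lra)) as P2.
  assert (W0 : W 0 = 0).
  { unfold W, Psi; rewrite a0, !RInt_point.
    change (@zero R_CompleteNormedModule) with 0; ring. }
  assert (WT : W T = sg * RInt f 0 T).
  { unfold W, Psi; rewrite aT, (RInt_point 0 e).
    change (@zero R_CompleteNormedModule) with 0; ring. }
  rewrite <- WT; nra.
Qed.

(** * The loop of a positive singular closed solution *)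

Definition cubic_exponent (A w : R -> R) (t : R) : R :=
  RInt (fun s => A s * w s ^ 2) 0 t.

Definition quadratic_exponent (B w : R -> R) (t : R) : R :=
  RInt (fun s => B s * w s) 0 t.

Lemma cont_cubic_exponent (A w : R -> R) :
  cont A -> cont w -> cont (cubic_exponent A w).
Proof. intros; unfold cubic_exponent; cont_tac. Qed.

Lemma cont_quadratic_exponent (B w : R -> R) :
  cont B -> cont w -> cont (quadratic_exponent B w).
Proof. intros; unfold quadratic_exponent; cont_tac. Qed.

Lemma is_derive_cubic_exponent (A w : R -> R) (t : R) :
  cont A -> cont w -> is_derive (cubic_exponent A w) t (A t * w t ^ 2).
Proof. intros; apply (RInt_is_derive (fun s => A s * w s ^ 2)); cont_tac. Qed.

Lemma is_derive_quadratic_exponent (B w : R -> R) (t : R) :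
  cont B -> cont w -> is_derive (quadratic_exponent B w) t (B t * w t).
Proof. intros; apply (RInt_is_derive (fun s => B s * w s)); cont_tac. Qed.

Lemma exponents_at_0 (A B w : R -> R) :
  cubic_exponent A w 0 = 0 /\ quadratic_exponent B w 0 = 0.
Proof.
  unfold cubic_exponent, quadratic_exponent; rewrite !RInt_point; split; reflexivity.
Qed.

Lemma solution_exp (A B w : R -> R) (T x t : R) :
  cont A -> cont B -> interior_solution A B T x w -> 0 <= t <= T ->
  w t = x * exp (cubic_exponent A w t + quadratic_exponent B w t).
Proof.
  intros HA HB [Cw [Iw Dw]] Ht.
  rewrite (linear_solution (fun s => 1 * (A s * w s ^ 2) + 1 * (B s * w s)) w T);
    [|cont_tac|exact Cw| |exact Ht].
  - rewrite Iw, (RInt_combination (fun s => A s * w s ^ 2) (fun s => B s * w s))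
      by cont_tac.
    unfold cubic_exponent, quadratic_exponent; f_equal; f_equal; ring.
  - intros s Hs; apply (is_derive_eq _ _ _ _ (Dw s Hs)); ring.
Qed.

Lemma solution_pos (A B w : R -> R) (T x t : R) :
  cont A -> cont B -> interior_solution A B T x w -> 0 < x -> 0 <= t <= T ->
  0 < w t.
Proof.
  intros HA HB Hw Px Ht; rewrite (solution_exp A B w T x t HA HB Hw Ht).
  apply Rmult_lt_0_compat; [exact Px|apply exp_pos].
Qed.

Lemma variation_exp (A B w : R -> R) (t : R) :
  cont A -> cont B -> cont w ->
  variation A B w t = exp (3 * cubic_exponent A w t + 2 * quadratic_exponent B w t).
Proof.
  intros HA HB Hw; unfold variation, cubic_exponent, quadratic_exponent; f_equal.
  rewrite <- RInt_combination by cont_tac.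
  apply RInt_ext; intros s _; match goal with |- ?l = ?r => change (@eq R l r) end; ring.
Qed.

Lemma singular_exponents (A B w : R -> R) (T x : R) :
  0 < T -> cont A -> cont B -> interior_solution A B T x w -> 0 < x ->
  w T = x -> variation A B w T = 1 ->
  cubic_exponent A w T = 0 /\ quadratic_exponent B w T = 0.
Proof.
  intros HT HA HB Hw Px H1 H2; assert (Cw : cont w) by apply Hw.
  rewrite variation_exp, <- exp_0 in H2 by assumption; apply exp_inv in H2.
  rewrite (solution_exp A B w T x T HA HB Hw) in H1 by lra.
  set (a := cubic_exponent A w T) in *; set (b := quadratic_exponent B w T) in *.
  assert (E : exp (a + b) = exp 0).
  { rewrite exp_0; apply (Rmult_eq_reg_l x); lra. }
  apply exp_inv in E; lra.
Qed.

(** With a, b the two exponents, w = x e^(a+b) and p = e^(3a+2b) give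
    (6 A w + 2 B) p = (2/x) (a' e^(2a+b) + (e^(2a+b))'), and the exact term
    integrates to zero over the loop. *)
Lemma second_variation (A B w : R -> R) (T x : R) :
  0 < T -> cont A -> cont B -> interior_solution A B T x w -> 0 < x ->
  w T = x -> variation A B w T = 1 ->
  RInt (fun t => (6 * A t * w t + 2 * B t) * variation A B w t) 0 T =
  2 / x * RInt (fun t => A t * w t ^ 2 *
                 exp (2 * cubic_exponent A w t + quadratic_exponent B w t)) 0 T.
Proof.
  intros HT HA HB Hw Px H1 H2; assert (Cw : cont w) by apply Hw.
  destruct (singular_exponents A B w T x HT HA HB Hw Px H1 H2) as [aT bT].
  destruct (exponents_at_0 A B w) as [a0 b0].
  assert (Ca : cont (cubic_exponent A w)) by now apply cont_cubic_exponent.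
  assert (Cb : cont (quadratic_exponent B w)) by now apply cont_quadratic_exponent.
  assert (Cp : cont (variation A B w)) by now apply cont_variation.
  set (a := cubic_exponent A w) in *; set (b := quadratic_exponent B w) in *.
  set (f := fun t => (6 * A t * w t + 2 * B t) * variation A B w t).
  set (g := fun t => A t * w t ^ 2 * exp (2 * a t + b t)).
  assert (Cf : cont f) by (unfold f; cont_tac).
  assert (Cg : cont g) by (unfold g; cont_tac).
  set (N := fun t => RInt f 0 t
                     + (-2 * / x) * (RInt g 0 t + exp (2 * a t + b t))).
  assert (E : N T = N 0).
  { apply (constant_of_zero_derivative N 0 T); [unfold N; cont_tac| |lra].
    intros t Ht.
    assert (D1 : is_derive a t (A t * w t ^ 2)) by now apply is_derive_cubic_exponent.
    assert (D2 : is_derive b t (B t * w t)) by now apply is_derive_quadratic_exponent.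
    pose proof (RInt_is_derive f t Cf) as D3.
    pose proof (RInt_is_derive g t Cg) as D4.
    unfold N; eapply is_derive_eq; [derive_steps|].
    unfold f, g; rewrite variation_exp by assumption; fold a b.
    pose proof (solution_exp A B w T x t HA HB Hw ltac:(lra)) as Ew; fold a b in Ew.
    replace (3 * a t + 2 * b t) with ((2 * a t + b t) + (a t + b t)) by ring.
    rewrite exp_plus.
    replace (exp (a t + b t)) with (w t / x) by (rewrite Ew; field; lra).
    field; lra. }
  unfold N in E; rewrite a0, b0, aT, bT, !RInt_point in E.
  change (@zero R_CompleteNormedModule) with 0 in E.
  unfold Rdiv; lra.
Qed.

(** The numerator is the function v of the hypothesis (C_3): the sign of v decides
    the convexity of the curve formed by the two exponents, whose slope is
    B / (A w). *)
Lemma slope_derivative (A B w : R -> R) (T x t A' B' : R) :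
  cont A -> cont B -> interior_solution A B T x w -> 0 < x ->
  0 < t < T -> A t <> 0 -> is_derive A t A' -> is_derive B t B' ->
  is_derive (fun s => B s / (A s * w s)) t
    (- (B t * (2 * A t * w t + B t) ^ 2 + (4 * (B t * A' - B' * A t) - B t ^ 3))
     / (4 * A t ^ 2 * w t)).
Proof.
  intros HA HB Hw Px Ht NA DA DB.
  pose proof (solution_pos A B w T x t HA HB Hw Px ltac:(lra)) as Pw.
  destruct Hw as [_ [_ Dw]]; pose proof (Dw t Ht) as D.
  derive_tac; [|field; lra].
  apply Rmult_integral_contrapositive; lra.
Qed.

Lemma second_variation_sign (A B w dA dB : R -> R) (T x sg c : R) :
  0 < T -> cont A -> cont B -> interior_solution A B T x w -> 0 < x ->
  0 < c < T ->
  (forall t, 0 < t < T -> t <> c -> A t <> 0) ->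
  (forall t, 0 < t < T -> is_derive A t (dA t)) ->
  (forall t, 0 < t < T -> is_derive B t (dB t)) ->
  w T = x -> variation A B w T = 1 ->
  (forall t, 0 < t < T ->
     0 < sg * (B t * (2 * A t * w t + B t) ^ 2
               + (4 * (B t * dA t - dB t * A t) - B t ^ 3))) ->
  0 < sg * RInt (fun t => (6 * A t * w t + 2 * B t) * variation A B w t) 0 T.
Proof.
  intros HT HA HB Hw Px Hc NA DA DB H1 H2 Hv; assert (Cw : cont w) by apply Hw.
  rewrite (second_variation A B w T x) by assumption.
  destruct (singular_exponents A B w T x HT HA HB Hw Px H1 H2) as [aT bT].
  destruct (exponents_at_0 A B w) as [a0 b0].
  assert (Pw : forall t, 0 < t < T -> 0 < w t).
  { intros t Ht; apply (solution_pos A B w T x); try assumption; lra. }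
  set (I := RInt _ 0 T).
  replace (sg * (2 / x * I)) with (2 / x * (sg * I)) by ring.
  apply Rmult_lt_0_compat; [apply Rdiv_lt_0_compat; lra|]; unfold I.
  set (v := fun t => B t * (2 * A t * w t + B t) ^ 2
                     + (4 * (B t * dA t - dB t * A t) - B t ^ 3)) in *.
  assert (dec : forall l r, 0 <= l -> r <= T -> ~ l < c < r ->
    forall s t, l < s -> s < t -> t < r ->
      sg * (B t / (A t * w t)) < sg * (B s / (A s * w s))).
  { intros l r Hl Hr Hlr.
    apply (decreasing_of_negative_derivative (fun s => sg * (B s / (A s * w s)))
             (fun t => sg * (- v t / (4 * A t ^ 2 * w t)))).
    - intros t Ht; assert (Ht' : 0 < t < T) by lra.
      assert (Nt : A t <> 0) by (apply NA; [exact Ht'|intros ->; apply Hlr; lra]).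
      pose proof (slope_derivative A B w T x t _ _ HA HB Hw Px Ht' Nt
                    (DA t Ht') (DB t Ht')) as D.
      apply (is_derive_eq _ _ _ _ (is_derive_Rmult _ _ t _ _ (is_derive_Rcst sg t) D)).
      fold (v t); ring.
    - intros t Ht; assert (Ht' : 0 < t < T) by lra.
      assert (Nt : A t <> 0) by (apply NA; [exact Ht'|intros ->; apply Hlr; lra]).
      assert (0 < 4 * A t ^ 2 * w t).
      { apply Rmult_lt_0_compat; [|now apply Pw]; pose proof (pow2_gt_0 _ Nt); lra. }
      replace (sg * (- v t / (4 * A t ^ 2 * w t)))
        with (- (sg * v t / (4 * A t ^ 2 * w t))) by (unfold Rdiv; ring).
      apply Ropp_lt_gt_0_contravar, Rdiv_lt_0_compat; [now apply Hv|assumption]. }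
  apply (exp_loop_integral_sign (cubic_exponent A w) (quadratic_exponent B w)
           (fun t => A t * w t ^ 2) (fun t => B t / (A t * w t)) sg c T); try assumption.
  - now apply cont_cubic_exponent.
  - now apply cont_quadratic_exponent.
  - cont_tac.
  - intros t _; now apply is_derive_cubic_exponent.
  - intros t Ht Hn.
    apply (is_derive_eq _ _ _ _ (is_derive_quadratic_exponent B w t HB Cw)).
    pose proof (Pw t Ht); pose proof (NA t Ht Hn).
    field; lra.
  - intros t Ht Hn; pose proof (Pw t Ht); pose proof (NA t Ht Hn).
    apply Rmult_integral_contrapositive; split; [assumption|apply pow_nonzero; lra].
  - apply (dec 0 c); lra.
  - apply (dec c T); lra.
Qed.

Theorem theorem1p1 :
  forall (T : R) (A B : R -> R) (u : R -> R -> R) (tA tB1 tB2 : R),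
    0 < T ->
    smooth_on (Icc 0 T) A ->
    smooth_on (Icc 0 T) B ->
    abel_flow A B T u ->
    condC1 A B T tA tB1 tB2 ->
    (forall x : R, positive_singular_closed A B T u x ->
       condC2 A B T tA (fun t => u t x) /\ condC3 A B T (fun t => u t x)) ->
    forall x : R, positive_singular_closed A B T u x ->
      exists uxx : R,
        is_derive_n (fun z => u T z) 2 x uxx /\
        sign uxx = sign (Derive_on (Icc 0 T) A 0 * B 0).
Proof.
  intros T A B u tA tB1 tB2 HT SA SB Hu C1 C23 x Hx.
  destruct (C23 x Hx) as [_ C3].
  destruct Hx as [Px [[Sx Clx] Dx]].
  destruct C1 as [_ [ZA [_ [ZB [_ [_ [O1 [O2 [O3 O4]]]]]]]]].
  (* Extension of all data by constants outside [0, T]. *)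
  set (A1 := fun t => A (clamp 0 T t)); set (B1 := fun t => B (clamp 0 T t)).
  set (W := fun z t => u (clamp 0 T t) z).
  assert (CA : cont A1) by (apply cont_extension; [lra|exact (SA 0%nat)]).
  assert (CB : cont B1) by (apply cont_extension; [lra|exact (SB 0%nat)]).
  assert (HW : solution_family A1 B1 T W).
  { intros z y Hy.
    apply (interior_solution_of_abel A B T z (fun t => u t z) HT), Hu.
    - unfold Icc; lra.
    - exists y; now apply abel_of_interior_solution. }
  assert (Wx : interior_solution A1 B1 T x (W x))
    by exact (interior_solution_of_abel A B T x (fun t => u t x) HT Sx).
  assert (WT : forall z, W z T = u T z) by (intro z; unfold W; now rewrite clamp_id by lra).
  assert (var1 : variation A1 B1 (W x) T = 1).
  { pose proof (family_derivative A1 B1 T x W HT CA CB HW Wx) as D.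
    apply (is_derive_ext _ (fun z => u T z)) in D; [|exact WT].
    apply is_derive_unique in D, Dx; congruence. }
  assert (WTx : W x T = x) by (rewrite WT; exact Clx).
  set (I := RInt (fun t => (6 * A1 t * W x t + 2 * B1 t) * variation A1 B1 (W x) t) 0 T).
  exists I; split.
  { pose proof (family_second_derivative A1 B1 T x W HT CA CB HW Wx) as D.
    rewrite var1, Rmult_1_r in D.
    apply (is_derive_n_ext _ (fun z => u T z)) in D; [exact D|exact WT]. }
  set (dA := Derive_on (Icc 0 T) A); set (dB := Derive_on (Icc 0 T) B).
  assert (DA : forall t, 0 < t < T -> is_derive A1 t (dA t)).
  { intros t Ht; apply is_derive_extension; [exact Ht|].
    apply Derive_on_interior; [exact Ht|]; apply (SA 0%nat); unfold Icc; lra. }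
  assert (DB : forall t, 0 < t < T -> is_derive B1 t (dB t)).
  { intros t Ht; apply is_derive_extension; [exact Ht|].
    apply Derive_on_interior; [exact Ht|]; apply (SB 0%nat); unfold Icc; lra. }
  assert (NA : forall t, 0 < t < T -> t <> tA -> A1 t <> 0).
  { intros t Ht Hn; unfold A1; rewrite clamp_id by lra; now rewrite (ZA t Ht). }
  set (v := fun t => B1 t * (2 * A1 t * W x t + B1 t) ^ 2
                     + (4 * (B1 t * dA t - dB t * A1 t) - B1 t ^ 3)).
  assert (V : forall t, 0 < t < T -> sign (v t) = sign (dA 0 * B 0)).
  { intros t Ht; transitivity (sign (vfun A B T t (u t x))); [|apply C3; lra].
    unfold v, vfun, Pfun, A1, B1, W; rewrite clamp_id by lra; reflexivity. }
  assert (main : forall sg, (forall t, 0 < t < T -> 0 < sg * v t) -> 0 < sg * I).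
  { intros sg Hsg; apply (second_variation_sign A1 B1 (W x) dA dB T x sg tA);
      try assumption; lra. }
  fold dA; destruct (Rtotal_order (dA 0 * B 0) 0) as [N|[Z|P]].
  - rewrite (sign_eq_m1 _ N) in *; apply sign_eq_m1.
    cut (0 < -1 * I); [lra|]; apply main; intros t Ht; specialize (V t Ht).
    destruct (Rlt_dec (v t) 0) as [|M]; [lra|].
    pose proof (sign_ge_0 (v t) ltac:(lra)); lra.
  (* The slope B / (A w) vanishes at tB1, hence also at tB1 / 2 when v = 0. *)
  - exfalso; rewrite Z, sign_0 in V.
    assert (V0 : forall t, 0 < t < T -> v t = 0).
    { intros t Ht; destruct (Req_dec (v t) 0) as [|N]; [assumption|].
      now apply sign_neq_0 in N; rewrite (V t Ht) in N. }
    destruct (MVT_cor2 (fun s => B1 s / (A1 s * W x s))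
                (fun t => - v t / (4 * A1 t ^ 2 * W x t)) (tB1 / 2) tB1 ltac:(lra))
      as [s [E Hs]].
    + intros t Ht; apply is_derive_Reals.
      apply (slope_derivative A1 B1 (W x) T x t _ _ CA CB Wx Px); [lra| | |].
      * apply NA; lra.
      * apply DA; lra.
      * apply DB; lra.
    + rewrite V0 in E by lra.
      assert (b1 : B1 tB1 = 0) by (unfold B1; rewrite clamp_id by lra; apply ZB; lra).
      assert (b2 : B1 (tB1 / 2) <> 0).
      { unfold B1; rewrite clamp_id by lra; rewrite ZB by lra; lra. }
      pose proof (NA (tB1 / 2) ltac:(lra) ltac:(lra)) as a2.
      pose proof (solution_pos A1 B1 (W x) T x (tB1 / 2) CA CB Wx Px ltac:(lra)) as w2.
      rewrite b1 in E.
      assert (Q : B1 (tB1 / 2) / (A1 (tB1 / 2) * W x (tB1 / 2)) = 0).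
      { unfold Rdiv in E; rewrite Ropp_0, !Rmult_0_l in E; unfold Rdiv; lra. }
      apply b2; apply (f_equal (fun r => r * (A1 (tB1 / 2) * W x (tB1 / 2)))) in Q.
      rewrite Rmult_0_l in Q; rewrite <- Q; field; lra.
  - rewrite (sign_eq_1 _ P) in *; apply sign_eq_1.
    cut (0 < 1 * I); [lra|]; apply main; intros t Ht; specialize (V t Ht).
    destruct (Rlt_dec 0 (v t)) as [|M]; [lra|].
    pose proof (sign_le_0 (v t) ltac:(lra)); lra.
Qed.
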